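(* Assume that $X$ is stationary, regularly varying and $\ell$-dependent for some $\ell\in\mathbb N$, that condition $\mathcal{AC}(r_n,u_n)$ holds and that $r_n^2w_n\to\infty$. Then for any bounded $H\in\mathcal H$, $$\limsup_{n\to\infty}\frac{E[H(u_n^{-1}X_{1,2r_n})1\{A_1\cap A_2\}]}{r_n^2w_n^2}<\infty.$$
   Context: Fix $d\ge1$, a norm $|\cdot|$ on $\mathbb R^d$, and a stationary regularly varying $\mathbb R^d$-valued time series $X=(X_j)_{j\in\mathbb Z}$ with tail index $\alpha>0$: there is a process $Y=(Y_j)_{j\in\mathbb Z}$ (the tail process) such that for all $i\le j$ the law of $x^{-1}(X_i,\dots,X_j)$ given $|X_0|>x$ converges weakly to the law of $(Y_i,\dots,Y_j)$ as $x\to\infty$. $u_n>0$, $r_n\in\mathbb N$, $w_n=P(|X_0|>u_n)$, with $u_n,r_n,nw_n\to\infty$, $r_n/n\to0$, $r_nw_n\to0$. $\ell_0$: sequences $x=(x_j)_{j\in\mathbb Z}$ in $\mathbb R^d$ tending to zero as $|j|\to\infty$, with the supremum norm. $x_{i,j}=(x_i,\dots,x_j)$, $x^*_{i,j}=\max_{i\le l\le j}|x_l|$, $x^*=\sup_j|x_j|$. Finite vectors are identified with elements of $\ell_0$ by zero padding, and functionals applied to them are shift-invariant. $T_{\min}(x)=\inf\{j:|x_j|>1\}$, $T_{\max}(x)=\sup\{j:|x_j|>1\}$. $\mathcal H$: the class of (shift-invariant) $H:\ell_0\to[0,\infty)$, almost surely continuous with respect to the law of $Y$, with $H(x)=0$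 if $x^*\le1$ and $H(x)=H(x_{T_{\min}(x),T_{\max}(x)})$ otherwise. $A_j=\{X^*_{(j-1)r_n+1,jr_n}>u_n\}$. Condition $\mathcal{AC}(r_n,u_n)$: for all $s,t>0$, $\lim_{k\to\infty}\limsup_{n\to\infty}P(\max_{k\le|j|\le r_n}|X_j|>u_ns\mid|X_0|>u_nt)=0$. *)

(* Defs.v *)
From HB Require Import structures.
From mathcomp Require Import all_boot all_order all_algebra.
From mathcomp Require Import all_classical all_reals all_analysis.

Set Implicit Arguments.
Unset Strict Implicit.
Unset Printing Implicit Defensive.

Import Order.TTheory GRing.Theory Num.Theory.
Import numFieldNormedType.Exports.

Local Open Scope classical_set_scope.
Local Open Scope ring_scope.

Definition is_norm (R : realType) (d : nat) (N : 'rV[R]_d -> R) : Prop :=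
  [/\ forall x, N x = 0 -> x = 0,
      forall (a : R) x, N (a *: x) = `|a| * N x &
      forall x y, N (x + y) <= N x + N y].

(* [sup] is the total supremum of reals, with [sup set0 = 0].  For D finite and
   nonempty this is the maximum of |x_l| over D; [seq_sup N x setT] is x^*. *)
Definition seq_sup (R : realType) (d : nat) (N : 'rV[R]_d -> R)
    (x : int -> 'rV[R]_d) (D : set int) : R :=
  sup [set N (x l) | l in D].

Definition seq_max (R : realType) (d : nat) (N : 'rV[R]_d -> R)
    (x : int -> 'rV[R]_d) (i j : int) : R :=
  seq_sup N x [set l | i <= l <= j].

(* Convergence is for the library topology of 'rV[R]_d; all norms on 'rV[R]_d
   induce it. *)
Definition ell0 (R : realType) (d : nat) : set (int -> 'rV[R]_d) :=
  [set x | (fun n : nat => x n%:Z) @ \oo --> (0 : 'rV[R]_d) /\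
           (fun n : nat => x (- n%:Z)) @ \oo --> (0 : 'rV[R]_d)].
Arguments ell0 {R d}.

(* The finite vector (x_i, ..., x_j), padded with zeros.  It is left in place:
   only shift-invariant functionals are applied to it. *)
Definition window (R : realType) (d : nat) (x : int -> 'rV[R]_d) (i j : int) :
    int -> 'rV[R]_d :=
  fun l => if i <= l <= j then x l else 0.

(* Integer infimum and supremum; the value 0 is used only when the set of
   exceedances is empty or unbounded, which does not happen for x in ell0 with
   x^* > 1. *)
Definition Tmin (R : realType) (d : nat) (N : 'rV[R]_d -> R)
    (x : int -> 'rV[R]_d) : int :=
  infimum 0 [set j | 1 < N (x j)].

Definition Tmax (R : realType) (d : nat) (N : 'rV[R]_d -> R)
    (x : int -> 'rV[R]_d) : int :=
  supremum 0 [set j | 1 < N (x j)].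

Definition ell0_continuous_at (R : realType) (d : nat) (N : 'rV[R]_d -> R)
    (H : (int -> 'rV[R]_d) -> R) (x : int -> 'rV[R]_d) : Prop :=
  forall e : R, 0 < e -> exists2 delta : R, 0 < delta &
    forall y, ell0 y -> seq_sup N (fun j => y j - x j) setT < delta ->
      `|H y - H x| < e.

Definition random_vector (dO : measure_display) (O : measurableType dO)
    (R : realType) (P : probability O R) (d : nat) :=
  {RV P >-> g_sigma_algebraType (@open 'rV[R]_d)}.

(* H is a function on ell0, represented by a total function whose values
   outside ell0 are never constrained.  No measurability of H is required. *)
Definition classH (R : realType) (d : nat) (N : 'rV[R]_d -> R)
    (dO : measure_display) (O : measurableType dO) (Q : probability O R)
    (Y : int -> random_vector Q d) (H : (int -> 'rV[R]_d) -> R) : Prop :=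
  [/\ forall x, ell0 x -> 0 <= H x,
      forall x (k : int), ell0 x -> H (fun j => x (j + k)) = H x,
      {ae Q, forall w, ell0 (Y ^~ w) -> ell0_continuous_at N H (Y ^~ w)},
      forall x, ell0 x -> seq_sup N x setT <= 1 -> H x = 0 &
      forall x, ell0 x -> 1 < seq_sup N x setT ->
        H x = H (window x (Tmin N x) (Tmax N x))].

Definition prob (dO : measure_display) (O : measurableType dO) (R : realType)
    (P : probability O R) (A : set O) : R :=
  fine (P A).

Definition cond_prob (dO : measure_display) (O : measurableType dO)
    (R : realType) (P : probability O R) (A B : set O) : R :=
  prob P (A `&` B) / prob P B.

(* The matrix whose m rows are X_i, ..., X_(i + m - 1). *)
Definition segment (dO : measure_display) (O : measurableType dO)
    (R : realType) (P : probability O R) (d : nat)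
    (X : int -> random_vector P d) (i : int) (m : nat) (w : O) : 'M[R]_(m, d) :=
  \matrix_(a < m, b < d) (X (i + a%:Z) w : 'rV[R]_d) ord0 b.

Definition stationary (dO : measure_display) (O : measurableType dO)
    (R : realType) (P : probability O R) (d : nat)
    (X : int -> random_vector P d) : Prop :=
  forall (i k : int) (m : nat) (B : set 'M[R]_(m, d)),
    <<s @open 'M[R]_(m, d) >> B ->
    P (segment X (i + k) m @^-1` B) = P (segment X i m @^-1` B).

(* Tail index: |X_0| is regularly varying at infinity with index - alpha.
   Tail process: weak convergence of finite-dimensional conditional laws,
   tested on bounded continuous functions. *)
Definition regularly_varying (R : realType) (d : nat) (N : 'rV[R]_d -> R)
    (dO : measure_display) (O : measurableType dO) (P : probability O R)
    (X : int -> random_vector P d) (alpha : R)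
    (dQ : measure_display) (OQ : measurableType dQ) (Q : probability OQ R)
    (Y : int -> random_vector Q d) : Prop :=
  (forall t : R, 0 < t ->
     prob P [set w | x * t < N (X 0 w)] / prob P [set w | x < N (X 0 w)]
       @[x --> +oo] --> t `^ (- alpha)) /\
  (forall (i : int) (m : nat) (f : 'M[R]_(m, d) -> R),
     continuous f -> (exists C : R, forall z, `|f z| <= C) ->
     (\int[P]_(w in [set w | x < N (X 0 w)%R]) f (x^-1 *: segment X i m w)) /
       prob P [set w | x < N (X 0 w)]
       @[x --> +oo] --> \int[Q]_w f (segment Y i m w)).

Definition sigma_of (dO : measure_display) (O : measurableType dO)
    (R : realType) (P : probability O R) (d : nat)
    (X : int -> random_vector P d) (D : set int) : set (set O) :=
  <<s [set A | exists j, exists2 B : set 'rV[R]_d,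
         D j /\ open B & A = X j @^-1` B] >>.

Definition l_dependent (dO : measure_display) (O : measurableType dO)
    (R : realType) (P : probability O R) (d : nat)
    (X : int -> random_vector P d) (l : nat) : Prop :=
  forall (i : int) (A B : set O),
    sigma_of X [set j | j <= i] A -> sigma_of X [set j | i + l%:Z < j] B ->
    (P (A `&` B) = P A * P B)%E.

Definition condition_AC (R : realType) (d : nat) (N : 'rV[R]_d -> R)
    (dO : measure_display) (O : measurableType dO) (P : probability O R)
    (X : int -> random_vector P d) (r : nat -> nat) (u : nat -> R) : Prop :=
  forall s t : R, 0 < s -> 0 < t ->
    limn_esup (fun n =>
      (cond_prob P
        [set w | u n * s <
           seq_sup N (X ^~ w) [set j | (k <= `|j| <= r n)%N]]
        [set w | u n * t < N (X 0 w)])%:E)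
    @[k --> \oo] --> 0%E.

Definition exc_prob (R : realType) (d : nat) (N : 'rV[R]_d -> R)
    (dO : measure_display) (O : measurableType dO) (P : probability O R)
    (X : int -> random_vector P d) (u : nat -> R) (n : nat) : R :=
  prob P [set w | u n < N (X 0 w)].

Definition block_exc (R : realType) (d : nat) (N : 'rV[R]_d -> R)
    (dO : measure_display) (O : measurableType dO) (P : probability O R)
    (X : int -> random_vector P d) (r : nat -> nat) (u : nat -> R)
    (n j : nat) : set O :=
  [set w | u n < seq_max N (X ^~ w) (j.-1 * r n).+1%:Z (j * r n)%:Z].

(* Main.v *)
Require Import Defs.
From HB Require Import structures.
From mathcomp Require Import all_boot all_order all_algebra.
From mathcomp Require Import all_classical all_reals all_analysis.
From mathcomp Require Import zify lra.

Set Implicit Arguments.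
Unset Strict Implicit.
Unset Printing Implicit Defensive.

Import Order.TTheory GRing.Theory Num.Theory.
Import numFieldNormedType.Exports.

Local Open Scope classical_set_scope.
Local Open Scope ring_scope.

(* On the intersection of the two block events some |X_i| with i in the first
   block and some |X_j| with j in the second exceed u_n. If j - i > l the two
   exceedances are independent, and summing over all pairs gives at most
   (r_n w_n)^2; if j - i <= l then i is among the last l times of the first
   block, which has probability at most l w_n. Since H is bounded, the ratio is
   O(1 + l / (r_n^2 w_n)), and r_n^2 w_n tends to infinity. *)

Lemma is_norm0 (R : realType) (d : nat) (N : 'rV[R]_d -> R) :
  is_norm N -> N 0 = 0.
Proof. by case=> _ NZ _; rewrite -(scale0r 0) NZ normr0 mul0r. Qed.

Lemma is_normN (R : realType) (d : nat) (N : 'rV[R]_d -> R) x :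
  is_norm N -> N (- x) = N x.
Proof. by case=> _ NZ _; rewrite -scaleN1r NZ normrN1 mul1r. Qed.

Lemma is_norm_le_sum (R : realType) (d : nat) (N : 'rV[R]_d -> R) :
  is_norm N -> forall x, N x <= \sum_j `|x 0 j| * N (delta_mx 0 j).
Proof.
move=> Nn x; have [_ NZ ND] := Nn.
rewrite [x in N x]row_sum_delta; elim/big_ind2 : _ => [|a b a' b' ha hb|j _].
- by rewrite is_norm0.
- by rewrite (le_trans (ND _ _))// lerD.
- by rewrite NZ.
Qed.

(** The reverse triangle inequality and the expansion in the standard basis bound [|N y - N x|] by a
    finite sum that vanishes as the coordinates of [y] tend to those of [x]. This makes exceedance
    sets open, hence measurable. *)
Lemma is_norm_continuous (R : realType) (d : nat) (N : 'rV[R]_d -> R) :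
  is_norm N -> continuous N.
Proof.
move=> Nn x; have [_ _ ND] := Nn.
have NB y : `|N y - N x| <= \sum_j `|y 0 j - x 0 j| * N (delta_mx 0 j).
  have := is_norm_le_sum Nn (y - x); under eq_bigr do rewrite !mxE.
  apply: le_trans; have := ND (y - x) x; rewrite subrK.
  have := ND (x - y) y; rewrite subrK -(is_normN (x - y) Nn) opprB.
  by rewrite ler_norml => ? ?; apply/andP; split; lra.
have : \sum_j `|(y : 'rV[R]_d) 0 j - x 0 j| * N (delta_mx 0 j) @[y --> x] -->
    \sum_j `|x 0 j - x 0 j| * N (delta_mx 0 j).
  apply: (@cvg_big _ _ _ _ _ _ _ _ _ _ _ (nbhs_filter x)) => [|j _].
    exact: (@add_continuous R^o).
  apply: cvgMr_tmp; apply: cvg_norm.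
  by apply: cvgB; [exact: coord_continuous|exact: cvg_cst].
rewrite [X in _ --> X]big1 => [sum0|j _]; last by rewrite subrr normr0 mul0r.
apply/(@cvgrPdist_lt _ _ _ _ (nbhs_filter x)) => e e0.
near=> y; rewrite distrC (le_lt_trans (NB y))//.
by near: y; exact: (cvgr_lt _ sum0 _ e0).
Unshelve. all: by end_near. Qed.

(* For a nonnegative non-measurable [f] the library integral is a lower
   integral, which is still monotone. *)
Lemma ge0_le_integral_nonmeasurable (dO : measure_display)
    (O : measurableType dO) (R : realType) (mu : {measure set O -> \bar R})
    (f g : O -> \bar R) :
  (forall x, 0 <= f x)%E -> (forall x, f x <= g x)%E ->
  (\int[mu]_x f x <= \int[mu]_x g x)%E.
Proof.
move=> f0 fg; have g0 x : (0 <= g x)%E by exact: le_trans (fg x).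
rewrite !ge0_integralTE//; apply: ereal_sup_le => _ [h /= hf <-].
by exists h => // x; exact: le_trans (fg x).
Qed.

Lemma probability_bigcup_le (dO : measure_display) (O : measurableType dO)
    (R : realType) (P : probability O R) (A : nat -> set O) (n : nat) (p : R) :
  (forall i, measurable (A i)) -> (forall i, (P (A i) <= p%:E)%E) ->
  (P (\bigcup_(i in `I_n) A i) <= (n%:R * p)%:E)%E.
Proof.
move=> mA Ap; rewrite bigcup_mkord.
apply: (le_trans (Boole_inequality _ _)) => [i _//|].
apply: (@le_trans _ _ (\sum_(i < n) p%:E)%E).
  by apply: lee_sum => i _; exact: Ap.
by rewrite sumEFin sumr_const card_ord mulr_natl.
Qed.

(** The limsup is an infimum of suprema over the sets of the filter, and the set where [v n <= M] is
    one of them. *)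
Lemma limn_esup_le_near (R : realType) (v : nat -> \bar R) (M : \bar R) :
  (\forall n \near \oo, (v n <= M)%E) -> (limn_esup v <= M)%E.
Proof.
move=> vM; apply: (@le_trans _ _ (ereal_sup (v @` [set n | (v n <= M)%E]))).
  by apply: ereal_inf_lbound; exists [set n | (v n <= M)%E].
by apply: ge_ereal_sup => _ [n /= vn <-].
Qed.

Lemma lt_seq_max (R : realType) (d : nat) (N : 'rV[R]_d -> R)
    (x : int -> 'rV[R]_d) (i j : int) (t : R) :
  0 <= t -> t < seq_max N x i j -> exists2 k : int, i <= k <= j & t < N (x k).
Proof.
move=> t0 tx; have := tx; rewrite /seq_max /seq_sup => /sup_gt[|_ [k ik <-] tk].
  (* An empty index range would give the default supremum 0, excluded by [0 <= t]. *)
  apply/set0P/eqP => S0; move: tx; rewrite /seq_max /seq_sup S0 sup0.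
  by rewrite ltNge t0.
by exists k.
Qed.

Lemma segment1 (dO : measure_display) (O : measurableType dO) (R : realType)
    (P : probability O R) (d : nat) (X : int -> random_vector P d) (i : int)
    (w : O) :
  segment X i 1 w = X i w.
Proof. by apply/rowP => b; rewrite mxE ord1 addr0. Qed.

(** Since [H] is constrained only on [ell0], this is what makes its bounds available at rescaled
    windows. *)
Lemma ell0_window (R : realType) (d : nat) (x : int -> 'rV[R]_d) (c : R)
    (i j : int) :
  ell0 (fun k => c *: window x i j k).
Proof.
split; apply/cvgrPdist_lt => e e0.
- exists (`|j|.+1)%N => // n /= jn.
  by rewrite /window ifF ?scaler0 ?subrr ?normr0//; lia.
- exists (`|i|.+1)%N => // n /= jn.
  by rewrite /window ifF ?scaler0 ?subrr ?normr0//; lia.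
Qed.

Section exceedances.
Context (R : realType) (d : nat) (N : 'rV[R]_d -> R).
Context (dO : measure_display) (O : measurableType dO) (P : probability O R).
Context (X : int -> random_vector P d).
Hypothesis N_norm : is_norm N.

Let E (t : R) (i : int) : set O := [set w | t < N (X i w)].

Lemma is_norm_open_gt t : open [set x | t < N x].
Proof.
apply: (@open_comp _ _ N [set y | t < y]) => [x _|]; last exact: open_gt.
exact: is_norm_continuous.
Qed.

Lemma measurable_exceedance t i : measurable (E t i).
Proof.
apply: (measurable_funPTI (X i) (Y := [set x | t < N x])).
by apply: sub_gen_smallest; exact: is_norm_open_gt.
Qed.

Lemma exceedance_stationary t i : stationary X -> P (E t i) = P (E t 0).
Proof.
move=> /(_ 0 i 1%N [set x | t < N x]); rewrite add0r.
have segE j : segment X j 1 @^-1` [set x | t < N x] = E t j.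
  by apply/seteqP; split => w /=; rewrite segment1.
by rewrite !segE; apply; apply: sub_gen_smallest; exact: is_norm_open_gt.
Qed.

Lemma exceedance_l_dependent t (i j : int) l : l_dependent X l ->
  i + l%:Z < j -> (P (E t i `&` E t j) = P (E t i) * P (E t j))%E.
Proof.
move=> /(_ i) Xl ij; apply: Xl; apply: sub_gen_smallest.
- exists i, [set x | t < N x] => //.
  by split; [exact: lexx|exact: is_norm_open_gt].
- exists j, [set x | t < N x] => //.
  by split => //; exact: is_norm_open_gt.
Qed.

(* The indices [r n - i] may be nonpositive when [l > r n]; this only enlarges
   the right-hand side. *)
Lemma block_exc_sub_bigcup (u : nat -> R) (r : nat -> nat) (n l : nat) :
  0 < u n ->
  block_exc N X r u n 1 `&` block_exc N X r u n 2 `<=`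
  \bigcup_(i in `I_l) E (u n) ((r n)%:Z - i%:Z) `|`
  \bigcup_(i in `I_(r n)) \bigcup_(j in `I_(r n))
    (if (i + l < r n + j)%N then
       E (u n) i.+1%:Z `&` E (u n) (r n + j).+1%:Z else set0).
Proof.
move=> un0 w [].
move=> /(lt_seq_max (ltW un0))[i /andP[i1 i2] Ei].
move=> /(lt_seq_max (ltW un0))[j /andP[j1 j2] Ej].
rewrite !mul1n mul0n in i1 i2 j1 j2.
have [a ia] : exists a : nat, i = a.+1%:Z by exists (`|i|.-1)%N; lia.
have [b jb] : exists b : nat, j = (r n + b).+1%:Z.
  by exists (`|j| - (r n).+1)%N; lia.
subst i j; have [far|close] := ltnP (a + l) (r n + b).
  right; exists a => /=; first by lia.
  exists b => /=; first by lia.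
  by rewrite far; split.
(* From [r n + b <= a + l] follows [r n - (a + 1) < l]: the first exceedance is among the last [l]
   times of its block, counted backwards from [r n]. *)
left; exists (r n - a.+1)%N => /=; first by lia.
by rewrite /E /= (_ : _ - _ = a.+1%:Z)//; lia.
Qed.

(** A measurable superset [V] is enough: its indicator dominates that of the two block events, and
    its integral is [P V]. *)
Lemma two_block_exc_bound (u : nat -> R) (r : nat -> nat) (n l : nat) :
  stationary X -> l_dependent X l -> 0 < u n ->
  exists V : set O, [/\ measurable V,
    block_exc N X r u n 1 `&` block_exc N X r u n 2 `<=` V &
    (P V <= (l%:R * exc_prob N X u n +
             (r n)%:R ^+ 2 * exc_prob N X u n ^+ 2)%:E)%E].
Proof.
move=> Xs Xl un0.
have PE i : P (E (u n) i) = (exc_prob N X u n)%:E.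
  rewrite exceedance_stationary// /exc_prob /prob fineK//.
  exact/fin_num_measure/measurable_exceedance.
have mE := measurable_exceedance (u n).
(* Close pairs get the empty set, so that all pairs obey the same bound, the squared exceedance
   probability. *)
set F := fun i j => if (i + l < r n + j)%N then
  E (u n) i.+1%:Z `&` E (u n) (r n + j).+1%:Z else set0.
have mF i j : measurable (F i j).
  by rewrite /F; case: ifP => _ //; exact: measurableI.
have PF i j : (P (F i j) <= (exc_prob N X u n ^+ 2)%:E)%E.
  rewrite /F; case: ifP => [far|_]; last by rewrite measure0 lee_fin sqr_ge0.
  by rewrite (exceedance_l_dependent _ Xl) ?PE ?expr2//; lia.
have mG i : measurable (\bigcup_(j in `I_(r n)) F i j).
  exact: fin_bigcup_measurable.
have mA : measurable (\bigcup_(i in `I_l) E (u n) ((r n)%:Z - i%:Z)).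
  exact: fin_bigcup_measurable.
have mB : measurable (\bigcup_(i in `I_(r n)) \bigcup_(j in `I_(r n)) F i j).
  exact: fin_bigcup_measurable.
exists (\bigcup_(i in `I_l) E (u n) ((r n)%:Z - i%:Z) `|`
        \bigcup_(i in `I_(r n)) \bigcup_(j in `I_(r n)) F i j); split.
- exact: measurableU.
- exact: block_exc_sub_bigcup.
apply: (le_trans (measureU2 _ mA mB)); rewrite EFinD; apply: leeD.
  by apply: probability_bigcup_le => // i; rewrite PE.
(* Two nested union bounds, each contributing one factor [r n]. *)
rewrite [(r n)%:R ^+ 2]expr2 -mulrA; apply: probability_bigcup_le => // i.
exact: probability_bigcup_le.
Qed.

End exceedances.

Theorem lemma5p3p8 (R : realType) (d : nat) (d_ge1 : (1 <= d)%N)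
  (N : 'rV[R]_d -> R) (N_norm : is_norm N)
  (dO : measure_display) (O : measurableType dO) (P : probability O R)
  (X : int -> random_vector P d)
  (dQ : measure_display) (OQ : measurableType dQ) (Q : probability OQ R)
  (Y : int -> random_vector Q d) (alpha : R)
  (X_stat : stationary X) (alpha_gt0 : 0 < alpha)
  (X_rv : regularly_varying N X alpha Y)
  (l : nat) (X_dep : l_dependent X l)
  (u : nat -> R) (r : nat -> nat)
  (u_gt0 : forall n, 0 < u n)
  (u_oo : u @ \oo --> +oo)
  (r_oo : r @ \oo --> \oo)
  (nw_oo : n%:R * exc_prob N X u n @[n --> \oo] --> +oo)
  (rn_0 : (r n)%:R / n%:R @[n --> \oo] --> (0 : R))
  (rw_0 : (r n)%:R * exc_prob N X u n @[n --> \oo] --> 0)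
  (AC : condition_AC N X r u)
  (r2w_oo : (r n)%:R ^+ 2 * exc_prob N X u n @[n --> \oo] --> +oo)
  (H : (int -> 'rV[R]_d) -> R) (H_class : classH N Y H)
  (H_bounded : exists C : R, forall x, ell0 x -> H x <= C) :
  (limn_esup (fun n =>
     'E_P[(fun w => H (fun j => (u n)^-1 *: window (X ^~ w) 1 (2 * r n)%N%:Z j)
                    * \1_(block_exc N X r u n 1 `&` block_exc N X r u n 2) w)%R]
     * (((r n)%:R ^+ 2 * exc_prob N X u n ^+ 2)^-1)%R%:E) < +oo)%E.
Proof.
have [C HC] := H_bounded; have [H_ge0 _ _ _ _] := H_class.
have C0 : 0 <= C.
  (* Evaluating [H] at the zero sequence gives [0 <= H <= C] there. *)
  have z : ell0 (fun j => 0 *: window (fun=> 0 : 'rV[R]_d) 0 0 j).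
    exact: ell0_window.
  exact: le_trans (H_ge0 _ z) (HC _ z).
(* With [p] the exceedance probability, the ratio is at most [C * (l / (r^2 p) + 1)], and eventually
   [r^2 p >= 1]. *)
apply: (@le_lt_trans _ _ (C * (l%:R + 1))%:E); last exact: ltry.
apply: limn_esup_le_near.
near=> n.
have rp1 : 1 <= (r n)%:R ^+ 2 * exc_prob N X u n.
  by near: n; move/cvgryPge : r2w_oo; exact.
set p := exc_prob N X u n in rp1 *.
have [V [mV sV PV]] := two_block_exc_bound N_norm r X_stat X_dep (u_gt0 n).
have p_gt0 : 0 < p.
  rewrite ltNge; apply/negP => p0.
  by have := mulr_ge0_le0 (sqr_ge0 (r n)%:R) p0; lra.
have q_gt0 : 0 < (r n)%:R ^+ 2 * p ^+ 2.
  by rewrite expr2 mulrA mulr_gt0//; lra.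
rewrite lee_pdivrMr//.
apply: (@le_trans _ _ (C%:E * P V)%E); last first.
  apply: (@le_trans _ _ (C * (l%:R * p + (r n)%:R ^+ 2 * p ^+ 2))%:E).
    by rewrite EFinM lee_wpmul2l.
  rewrite -EFinM lee_fin -(mulrA C) ler_wpM2l// mulrDl mul1r lerD2r.
  (* This is [p <= (r^2 p) p]. *)
  by rewrite ler_wpM2l// [p ^+ 2]expr2 mulrA ler_peMl// ltW.
have -> : (C%:E * P V = \int[P]_w (C * \1_V w)%:E)%E.
  rewrite -[V in P V]setIT -(integral_indic P measurableT mV).
  by rewrite (integralZl_indic measurableT (fun=> V))// ltNge C0.
(* [H] may be non-measurable, so the expectation is compared with that of [C] times the indicator of
   [V] by pointwise domination alone. *)
rewrite unlock; apply: ge0_le_integral_nonmeasurable => w; rewrite lee_fin.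
  by rewrite mulr_ge0// H_ge0//; exact: ell0_window.
set B := block_exc _ _ _ _ _ _ `&` _.
have HCw := HC _ (ell0_window (X ^~ w) (u n)^-1 1 (2 * r n)%N%:Z).
apply: ler_pM => //; first by rewrite H_ge0//; exact: ell0_window.
by rewrite !indicE; have [/set_mem/sV/mem_set->|] := boolP (w \in B).
Unshelve. all: by end_near. Qed.
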